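(* (a) If the sequence $\mathbf p=(p_n)\subset[1,\infty)$ is unbounded, then every modular ball in $\ell^{(p_n)}$ has empty $\tau_{\rho_{\mathbf p}}$-interior. (b) Let $\Omega\subset\mathbb{R}^n$ be a bounded domain and let $p\in C(\Omega)$ satisfy $1\le p(x)<\infty$ for every $x\in\Omega$, with $p^+=\sup_\Omega p=\infty$. Then every modular ball in $L^{p(\cdot)}(\Omega)$ has empty interior in the modular topology $\tau_{\rho_p}$.
   Context: Sequence space: for $\mathbf p=(p_n)\subset[1,\infty)$ and a real sequence $(a_j)$, $\rho_{\mathbf p}((a_j))=\sum_{j=1}^\infty|a_j|^{p_j}\in[0,\infty]$, and $\ell^{(p_n)}=\{(a_j)\in\mathbb{R}^{\mathbb N}:\rho_{\mathbf p}(\lambda(a_j))<\infty\text{ for some }\lambda>0\}$. Lebesgue space: for measurable $u$ on $\Omega$ (functions equal a.e. being identified), $\rho_p(u)=\int_\Omega|u(x)|^{p(x)}\,dx$, and $L^{p(\cdot)}(\Omega)=\{u:\rho_p(\lambda u)<\infty\text{ for some }\lambda>0\}$. A domain is a nonempty connected open set. For either space, denoted $E$ with modular $\rho$, the modular ball of center $x\in E$ and radius $\varepsilon>0$ is $B_{\rho,\varepsilon}(x)=\{y\in E:\rho(y-x)<\varepsilon\}$, and the modular topology $\tau_\rho$ is: $A\subseteq E$ is $\tau_\rho$-open iff for every $x\in A$ there exists $\varepsilon>0$ with $B_{\rho,\varepsilon}(x)\subset A$. *)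

(* Defs.v *)
From HB Require Import structures.
From mathcomp Require Import all_boot all_order all_algebra.
From mathcomp Require Import generic_quotient ring_quotient.
From mathcomp Require Import all_classical all_reals all_analysis.

Set Implicit Arguments.
Unset Strict Implicit.
Unset Printing Implicit Defensive.

Import Order.TTheory GRing.Theory Num.Theory.
Import numFieldNormedType.Exports.

Local Open Scope classical_set_scope.
Local Open Scope ring_scope.
Local Open Scope quotient_scope.

(* The set E seen as a space with modular rho.  This alias keeps the modular
   topology below apart from the subspace topology of set_type E. *)
Definition modular_space (R : realType) (V : zmodType) (E : set V)
  (rho : V -> \bar R) : Type := set_type E.

Section modular_topology.
Context {R : realType} {V : zmodType} {E : set V} {rho : V -> \bar R}.
Local Notation X := (modular_space E rho).

HB.instance Definition _ := Choice.copy X (set_type E).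

Definition modular_ball (x : X) (e : R) : set X :=
  [set y : X | (rho ((set_val y : V) - (set_val x : V)) < e%:E)%E].

Definition modular_open : set (set X) :=
  [set A | forall x, A x -> exists2 e : R, 0 < e & modular_ball x e `<=` A].

Lemma modular_openT : modular_open setT.
Proof. by move=> x _; exists 1. Qed.

Lemma modular_openI : setI_closed modular_open.
Proof.
move=> A B oA oB x [/oA[e e0 eA] /oB[f f0 fB]].
exists (Num.min e f); first by rewrite lt_min e0.
move=> y; rewrite /modular_ball/= EFin_min lt_min => /andP[ye yf].
by split; [exact: eA|exact: fB].
Qed.

Lemma modular_open_bigU (I : Type) (f : I -> set X) :
  (forall i, modular_open (f i)) -> modular_open (\bigcup_i f i).
Proof.
move=> of_ x [i _ /of_[e e0 ef]]; exists e => // y /ef fy.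
by exists i.
Qed.

HB.instance Definition _ := isOpenTopological.Build X
  modular_openT modular_openI modular_open_bigU.

Lemma modular_openE : (open : set (set X)) = modular_open.
Proof. by []. Qed.

End modular_topology.

Section variable_exponent_sequences.
Context {R : realType}.
Implicit Types (p a : nat -> R).

Definition seq_modular p a : \bar R :=
  (\sum_(0 <= j <oo) (`|a j| `^ p j)%:E)%E.

Definition seq_space p : set (nat -> R) :=
  [set a | exists2 l : R, 0 < l & (seq_modular p (fun j => l * a j)%R < +oo)%E].

End variable_exponent_sequences.

Notation var_lseq p := (modular_space (seq_space p) (seq_modular p)).

Section variable_exponent_lebesgue.
Context d (T : measurableType d) (R : realType).
Variables (mu : {measure set T -> \bar R}) (D : set T).
Implicit Types (p u : T -> R).

Definition ae_zero : {pred (T -> R)} :=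
  fun u => `[< u = cst 0 %[ae mu in D] >].

Lemma ae_zero_zmod_closed : zmod_closed ae_zero.
Proof.
split=> [|u v /asboolP u0 /asboolP v0]; apply/asboolP.
  exact: ae_eq_refl.
apply: filterS2 u0 v0 => x u0 v0 Dx.
by have -> : (u - v) x = u x - v x by []; rewrite u0// v0//= subr0.
Qed.

HB.instance Definition _ :=
  GRing.isZmodClosed.Build (T -> R) ae_zero ae_zero_zmod_closed.

(* Classes of functions T -> R modulo equality mu-almost everywhere on D;
   values outside of D are irrelevant. *)
Definition ae_class : Type := {ideal_quot ae_zero}.
HB.instance Definition _ := GRing.Zmodule.on ae_class.
HB.instance Definition _ := EqQuotient.on ae_class.

Definition fun_modular p u : \bar R :=
  (\int[mu]_(x in D) (`|u x| `^ p x)%:E)%E.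

(* The integral is evaluated on a representative. If mu is complete, as is
   lebesgue_rV below, then every representative of a class in class_space is
   measurable on a measurable D and the value does not depend on the choice. *)
Definition class_modular p (f : ae_class) : \bar R := fun_modular p (repr f).

Definition class_space p : set ae_class :=
  [set \pi_ae_class u | u in [set u : T -> R | measurable_fun D u /\
     exists2 l : R, 0 < l & (fun_modular p (fun x => l * u x)%R < +oo)%E]].

End variable_exponent_lebesgue.

Arguments class_space {d T R} mu D p _.
Arguments class_modular {d T R} mu D p f.

Notation var_Lspace mu D p :=
  (modular_space (class_space mu D p) (class_modular mu D p)).

(* Lebesgue measure on R^n.+1: the outer measure obtained from coverings by
   half-open boxes, restricted to its Caratheodory measurable sets. In dimension
   0 a box cannot be empty, which this construction does not account for. *)
Section lebesgue_measure_rV.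
Context {R : realType} {n : nat}.
Local Notation rV := 'rV[R]_n.+1.
Implicit Types (c : rV * rV) (A : set rV).
Local Open Scope ereal_scope.

Definition box c : set rV :=
  [set x | forall i, (c.1 ord0 i < x ord0 i <= c.2 ord0 i)%R].

Definition box_volume c : \bar R :=
  (\prod_i Num.max 0 (c.2 ord0 i - c.1 ord0 i))%R%:E.

Definition box_cover A : set (nat -> rV * rV) :=
  [set c | A `<=` \bigcup_k box (c k)].

Definition lebesgue_outer A : \bar R :=
  ereal_inf [set \sum_(0 <= k <oo) box_volume (c k) | c in box_cover A].

Lemma box_volume_ge0 c : 0 <= box_volume c.
Proof. by rewrite lee_fin; apply: prodr_ge0 => i _; rewrite le_max lexx. Qed.

Lemma lebesgue_outer0 : lebesgue_outer set0 = 0.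
Proof.
apply/eqP; rewrite eq_le; apply/andP; split; last first.
  by apply: le_ereal_inf_tmp => _ [c _ <-]; apply: nneseries_ge0 => j _ _; exact: box_volume_ge0.
apply: ereal_inf_lbound; exists (fun=> (0, 0)%R) => //=.
apply: eseries0 => k _ _; rewrite /box_volume/= big_ord_recl mxE subrr maxxx.
by rewrite mul0r.
Qed.

Lemma lebesgue_outer_ge0 A : 0 <= lebesgue_outer A.
Proof.
by apply: le_ereal_inf_tmp => _ [c _ <-]; apply: nneseries_ge0 => j _ _; exact: box_volume_ge0.
Qed.

Lemma le_lebesgue_outer :
  {homo lebesgue_outer : A B / A `<=` B >-> A <= B}.
Proof.
move=> A B AB; apply: ereal_inf_le_tmp => _ [c Bc <-].
by exists c => //; exact: subset_trans Bc.
Qed.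

Lemma lebesgue_outer_sigma_subadditive : sigma_subadditive lebesgue_outer.
Proof.
move=> A; have [[i ioo]|] := pselect (exists i, lebesgue_outer (A i) = +oo).
  rewrite (eseries_pinfty _ _ ioo) ?leey// => k _.
  by rewrite -ltNye (lt_le_trans _ (lebesgue_outer_ge0 _)).
rewrite -forallNE => Aoo; apply/lee_addgt0Pr => _/posnumP[e].
rewrite (le_trans _ (epsilon_trick _ _ _))//; last first.
  by move=> k; exact: lebesgue_outer_ge0.
pose P k (c : nat -> rV * rV) := box_cover (A k) c /\
  \sum_(0 <= j <oo) box_volume (c j) <=
    lebesgue_outer (A k) + (e%:num / (2 ^ k.+1)%:R)%:E.
have [G PG] : {G : nat -> nat -> rV * rV & forall k, P k (G k)}.
  apply: (@choice _ _ P) => k.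
  have fA : lebesgue_outer (A k) \is a fin_num.
    by rewrite ge0_fin_numE ?lebesgue_outer_ge0// ltey; exact/eqP/Aoo.
  have e0 : (0 < e%:num / (2 ^ k.+1)%:R)%R by [].
  have [_ [c Ac <-] cA] := lb_ereal_inf_adherent e0 fA.
  by exists c; split => //; exact: ltW.
pose v (i : nat * nat) := box_volume (G i.1 i.2).
have v0 i : 0 <= v i by exact: box_volume_ge0.
apply: (@le_trans _ _ (\sum_(0 <= k <oo) \sum_(0 <= j <oo) v (k, j))); last first.
  apply: lee_nneseries => [k _ _|k _]; last exact: (PG k).2.
  by apply: nneseries_ge0 => j _ _; exact: v0.
have -> : \sum_(0 <= k <oo) \sum_(0 <= j <oo) v (k, j) =
    \esum_(i in [set: nat * nat]) v i.
  rewrite nneseries_esumT; last first.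
    by move=> k; apply: nneseries_ge0 => j _ _; exact: v0.
  under eq_esum do rewrite nneseries_esumT//.
  rewrite esum_esum//; congr esum.
  by apply/seteqP; split => -[].
have /card_esym/ppcard_eqP[f] := card_nat2.
apply: ereal_inf_lbound; exists (fun i => G (f i).1 (f i).2).
  move=> x [k _ /(PG k).1[j _ xkj]]; exists (f^-1%FUN (k, j)) => //=.
  by rewrite invK ?inE.
rewrite nneseries_esumT; last by move=> *; exact: box_volume_ge0.
by rewrite (reindex_esum setT setT f)//; exact: bijTT.
Qed.

HB.instance Definition _ := isOuterMeasure.Build R rV lebesgue_outer
  lebesgue_outer0 lebesgue_outer_ge0 le_lebesgue_outer
  lebesgue_outer_sigma_subadditive.

Definition lebesgue_rV :
  set (caratheodory_type lebesgue_outer) -> \bar R := lebesgue_outer.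

HB.instance Definition _ := isMeasure.Build _ _ _ lebesgue_rV
  (@caratheodory_measure0 R _ lebesgue_outer)
  (@caratheodory_measure_ge0 R _ lebesgue_outer)
  (@caratheodory_measure_sigma_additive R _ lebesgue_outer).

End lebesgue_measure_rV.

(* Main.v *)
Require Import Defs.
From HB Require Import structures.
From mathcomp Require Import all_boot all_order all_algebra.
From mathcomp Require Import all_classical all_reals all_analysis.
From mathcomp Require Import generic_quotient ring_quotient measurable_realfun lra ring.

(** An open subset A of a modular ball around x that contains y is left in two
    steps.  Put w = y - x, pick sets B_k of positive finite measure on which
    p >= k^2, and let u = sgn(w) g^(1/p) with
    g = sum_k eps 2^(-k-1) / mu(B_k) 1_{B_k}.  Then rho(u) = int g is small, so
    y + u lies in A, and rho(delta u) <= delta rho(u) is small, so y + u + delta u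
    lies in A for some delta > 0.  But u has the sign of w, so
    rho(w + (1 + delta) u) >= sup_k (1 + delta)^(k^2) eps 2^(-k-1) = +oo.
    Sequence spaces are the case of the counting measure.  For Lebesgue measure
    the B_k are boxes inside the open sets {p > k^2}; that a box is not covered
    by boxes of smaller total volume follows by induction on the dimension,
    integrating the indicators over the first coordinate. *)

Set Implicit Arguments.
Unset Strict Implicit.
Unset Printing Implicit Defensive.

Import Order.TTheory GRing.Theory Num.Theory.
Import numFieldNormedType.Exports.

Local Open Scope classical_set_scope.
Local Open Scope ring_scope.

(** * Modular topology: leaving a ball in two steps *)

(** Here w stands for y - x. The quantifier on [eta] comes after u because the radius of a ball
    inside the open set around y + u is known only once u is fixed. *)
Lemma modular_ball_interior0 (R : realType) (V : zmodType) (E : set V)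
    (rho : V -> \bar R) (x : modular_space E rho) (e : R) :
  (forall u v, E u -> E v -> E (u - v)) ->
  (forall w, E w -> forall eps : R, 0 < eps ->
    exists u, [/\ E u, (rho u < eps%:E)%E &
      forall eta : R, 0 < eta ->
      exists v, [/\ E v, (rho v < eta%:E)%E & (e%:E <= rho (w + u + v)%R)%E]]) ->
  (modular_ball x e)° = set0.
Proof.
move=> EB Erho; rewrite -subset0 => y; rewrite /interior nbhsE /=.
move=> [A [oA Ay] Axe].
have Eval (z : modular_space E rho) : E (set_val z) by exact: set_valP.
have ED u v : E u -> E v -> E (u + v).
  move=> Eu Ev; rewrite -[v]opprK -[- v]add0r -(subrr v).
  by apply: (EB) => //; do 2 apply: (EB) => //.
have [eps eps0 yA] := oA _ Ay.
have [u [Eu ueps Eeta]] := Erho _ (EB _ _ (Eval y) (Eval x)) _ eps0.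
pose z : modular_space E rho := exist (fun v => v \in E) _ (mem_set (ED _ _ (Eval y) Eu)).
have Az : A z by apply: yA; rewrite /modular_ball/= addrC addKr.
have [eta eta0 zA] := oA _ Az.
have [v [Ev veta]] := Eeta _ eta0.
pose t : modular_space E rho := exist (fun v => v \in E) _ (mem_set (ED _ _ (Eval z) Ev)).
have /Axe : A t by apply: zA; rewrite /modular_ball/= [X in rho X]addrC addKr.
rewrite /modular_ball/= => te.
by rewrite leNgt -!addrA [- _ + _]addrC !addrA te.
Qed.

(** * Variable powers and a growth estimate *)

Lemma measurable_fun_powR_exponent d (T : measurableType d) (R : realType) (D : set T)
    (f g : T -> R) : measurable D -> measurable_fun D f -> measurable_fun D g ->
  measurable_fun D (fun x => f x `^ g x).
Proof.
move=> mD mf mg; rewrite /powR; apply: measurable_fun_if => //.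
- by apply: measurable_fun_eqr => //; exact: measurable_cst.
- apply: (measurable_funS mD) => //.
  apply: (measurableT_comp (f := fun b : bool => b%:R : R)) => //.
  by apply: measurable_fun_eqr => //; exact: measurable_cst.
- apply: (measurable_funS mD) => //.
  apply: measurableT_comp => //; apply: measurable_funM => //.
  exact: measurableT_comp.
Qed.

Lemma measurable_funV_ge1 d (T : measurableType d) (R : realType) (D : set T)
    (f : T -> R) : measurable_fun D f -> (forall x, D x -> 1 <= f x) ->
  measurable_fun D (fun x => (f x)^-1).
Proof.
move=> mf f1; apply: (eq_measurable_fun (fun x => f x `^ (-1))).
  by move=> x /[!inE] /f1 fx1; rewrite powR_inv1// (le_trans _ fx1).
exact: (measurableT_comp (@measurable_powR R (-1)) mf).
Qed.

Lemma bernoulli_ge (R : realDomainType) (a : R) n : 0 <= a ->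
  1 + n%:R * a <= (1 + a) ^+ n.
Proof.
move=> a0; elim: n => [|n IHn]; first by rewrite mul0r addr0.
rewrite exprS; apply: le_trans (ler_wpM2l _ IHn); last by rewrite addr_ge0.
rewrite mulrDl mul1r [a * _]mulrDr mulr1 -natr1 mulrDl mul1r addrA addrAC.
by rewrite addrA [leLHS]addrAC lerDl mulr_ge0// mulr_ge0.
Qed.

(** Once k a >= 3, Bernoulli gives (1 + a)^k >= 4, hence (1 + a)^(k^2) >= 4^k. One factor 2^k
    absorbs the denominator and the other exceeds k, which can be taken as large as M requires. A
    linear exponent k would not do for small a. *)
Lemma exp_square_dominates (R : realType) (a b M : R) : 0 < a -> 0 < b ->
  exists k, M <= (1 + a) ^+ (k * k) * (b / (2 ^ k.+1)%:R).
Proof.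
move=> a0 b0; pose k := maxn (Num.truncn (3 / a)).+1 (Num.truncn (2 * M / b)).+1.
exists k.
have ak : 3 <= k%:R * a.
  rewrite -ler_pdivrMr//; apply/ltW/(lt_le_trans (truncnS_gt _)).
  by rewrite ler_nat leq_maxl.
have bk : M <= b * (k%:R / 2).
  rewrite -ler_pdivrMl// -[leLHS]mulr1 ler_pdivlMr// mulr1.
  rewrite mulrC mulrCA mulrA [_ * M]mulrC.
  apply: (@le_trans _ _ (2 * M / b)); first by rewrite mulrC; lra.
  by apply/ltW/(lt_le_trans (truncnS_gt _)); rewrite ler_nat leq_maxr.
have k2 : k%:R <= 2 ^+ k :> R.
  by rewrite -natrX ler_nat ltnW// ltn_expl.
have -> : (1 + a) ^+ (k * k) * (b / (2 ^ k.+1)%:R) =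
    b * ((1 + a) ^+ (k * k) / 2 ^+ k / 2).
  by rewrite natrX exprSr invfM; ring.
apply: (le_trans bk); rewrite ler_pM2l// ler_pM2r// ler_pdivlMr ?exprn_gt0//.
apply: (@le_trans _ _ ((2 * 2) ^+ k)).
  by rewrite exprMn ler_pM2r ?exprn_gt0.
rewrite exprM lerXn2r ?nnegrE ?exprn_ge0 ?addr_ge0 ?(ltW a0)//.
by apply: le_trans (bernoulli_ge _ (ltW a0)); lra.
Qed.

(** * The weight g and the perturbation built from it *)

(** Each indicator is normalised to have integral eps / 2^(k+1), and these integrals sum to eps.
    Disjointness of the B k is not assumed: by nonnegativity, the k-th term alone bounds the
    integral of g over B k from below. *)
Lemma exists_weight d (T : measurableType d) (R : realType)
    (mu : {measure set T -> \bar R}) (D : set T) (B : nat -> set T) (eps : R) :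
  measurable D -> (forall k, measurable (B k)) -> (forall k, B k `<=` D) ->
  (forall k, 0 < mu (B k) < +oo)%E -> 0 < eps ->
  exists g : T -> R, [/\ measurable_fun D g, forall x, 0 <= g x,
    (\int[mu]_(x in D) (g x)%:E <= eps%:E)%E &
    forall k, ((eps / (2 ^ k.+1)%:R)%:E <= \int[mu]_(x in B k) (g x)%:E)%E].
Proof.
move=> mD mB BD muB eps0.
pose a k := eps / (2 ^ k.+1)%:R.
have a0 k : 0 < a k by rewrite divr_gt0// ltr0n expn_gt0.
pose m k := fine (mu (B k)).
have muE k : mu (B k) = (m k)%:E.
  by rewrite fineK// ge0_fin_numE// (andP (muB k)).2.
have m0 k : 0 < m k by rewrite -lte_fin -muE (andP (muB k)).1.
pose f k x : \bar R := ((a k / m k)%:E * (\1_(B k) x)%:E)%E.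
have f0 k x : (0 <= f k x)%E.
  by rewrite mule_ge0 ?lee_fin// divr_ge0// ltW.
have mf k E : measurable_fun E (f k).
  by apply: measurable_funeM; exact/measurable_EFinP/measurable_indic.
have fE k (E : set T) : measurable E -> B k `<=` E ->
    (\int[mu]_(x in E) f k x = (a k)%:E)%E.
  move=> mE BE; rewrite ge0_integralZl//; last 2 first.
  - exact/measurable_EFinP/measurable_indic.
  - by rewrite lee_fin divr_ge0// ltW.
  by rewrite integral_indic// setIidl// muE -EFinM divfK// gt_eqF.
pose h x : \bar R := (\sum_(0 <= k <oo) f k x)%E.
have h0 x : (0 <= h x)%E by apply: nneseries_ge0 => k _ _.
have mh E : measurable_fun E h by apply: ge0_emeasurable_sum => // k _.
have inth : (\int[mu]_(x in D) h x <= eps%:E)%E.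
  rewrite integral_nneseries//; under eq_eseriesr do rewrite fE//.
  exact: epsilon_trick0 (ltW eps0).
(* The series h may take the value +oo, but only on a null set since its integral is finite. Passing
   to the real-valued [fine] of h therefore changes no integral. *)
have hfin : {ae mu, forall x, D x -> h x \is a fin_num}.
  apply: integrable_ae => //; apply/integrableP; split => //.
  under eq_integral do rewrite gee0_abs//.
  exact: le_lt_trans inth (ltry _).
have gE E : measurable E -> E `<=` D ->
    (\int[mu]_(x in E) (fine (h x))%:E = \int[mu]_(x in E) h x)%E.
  move=> mE ED; apply: ge0_ae_eq_integral => //.
  - by apply/measurable_EFinP; exact: measurableT_comp.
  - by move=> x _; rewrite lee_fin fine_ge0.
  - by apply: filterS hfin => x hx /ED /hx hfinx; rewrite fineK.
exists (fine \o h); split => /=.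
- exact: measurableT_comp.
- by move=> x; rewrite fine_ge0.
- by rewrite gE.
- move=> k; rewrite gE// -[X in (X <= _)%E](fE k (B k))//.
  apply: ge0_le_integral => // x _.
  rewrite /h (@nneseriesD1 _ _ k)// leeDl// nneseries_ge0//.
Qed.

Lemma exists_perturbation d (T : measurableType d) (R : realType)
    (mu : {measure set T -> \bar R}) (D : set T) (p w : T -> R) (eps e : R) :
  measurable D -> measurable_fun D p -> (forall x, D x -> 1 <= p x) ->
  (forall m : nat, exists B, [/\ measurable B, B `<=` D,
     (0 < mu B < +oo)%E & forall x, B x -> m%:R <= p x]) ->
  measurable_fun D w -> 0 < eps ->
  exists u, [/\ measurable_fun D u, (fun_modular mu D p u < eps%:E)%E &
    forall eta : R, 0 < eta ->
    exists v, [/\ measurable_fun D v, (fun_modular mu D p v < eta%:E)%E &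
      (e%:E <= fun_modular mu D p (w + u + v)%R)%E]].
Proof.
move=> mD mp p1 pB mw eps0.
have /choice[B PB] : forall k, exists B, [/\ measurable B, B `<=` D,
    (0 < mu B < +oo)%E & forall x, B x -> (k * k)%:R <= p x].
  by move=> k; exact: pB.
have BD k : B k `<=` D by case: (PB k).
have mB k : measurable (B k) by case: (PB k).
(* The weight has integral at most its parameter; using eps / 2 makes the bound on the modular of u
   strict. *)
have eps20 : 0 < eps / 2 by rewrite divr_gt0.
have muB k : (0 < mu (B k) < +oo)%E by case: (PB k).
have [g [mg g0 gD gB]] := exists_weight mD mB BD muB eps20.
(* The value 1 at zeros of w keeps |s| = 1 everywhere, so that |u|^p = g on all of D, and u never
   points against w. *)
pose s x : R := if w x < 0 then -1 else 1.
have ms : measurable_fun D s.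
  apply: measurable_fun_if => //.
  by apply: measurable_fun_ltr => //; exact: measurable_cst.
pose u x := s x * g x `^ (p x)^-1.
have mfu : measurable_fun D u.
  by apply: measurable_funM => //; apply: measurable_fun_powR_exponent => //;
    exact: measurable_funV_ge1.
have normu x : `|u x| = g x `^ (p x)^-1.
  rewrite normrM (ger0_norm (powR_ge0 _ _)) /s.
  by case: ifPn => _; rewrite ?normrN normr1 mul1r.
have scaleuE (c : R) x : 0 <= c -> D x ->
    (c * `|u x|) `^ p x = c `^ p x * g x.
  move=> c0 Dx; have px0 : p x != 0.
    by rewrite gt_eqF// (lt_le_trans ltr01)// p1.
  by rewrite normu powRM ?powR_ge0// -powRrM mulVf// powRr1.
have uE : fun_modular mu D p u = (\int[mu]_(x in D) (g x)%:E)%E.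
  apply: eq_integral => x /[!inE] Dx.
  by rewrite -[`|u x|]mul1r scaleuE// powR1 mul1r.
have gE0 x : (0 <= (g x)%:E)%E by rewrite lee_fin.
have mgE : measurable_fun D (fun x => (g x)%:E) by exact/measurable_EFinP.
exists u; split => //.
  by rewrite uE (le_lt_trans gD)// lte_fin gtr_pMr// invf_lt1// ltr1n.
move=> eta eta0.
(* Since del <= 1 <= p, del^p <= del, so the modular of del u is at most del eps / 2 <= eta / 2 <
   eta. *)
pose del := Num.min 1 (eta / eps).
have del0 : 0 < del by rewrite lt_min ltr01 divr_gt0.
have del1 : del <= 1 by rewrite ge_min lexx.
exists (fun x => del * u x); split.
- exact: measurable_funM.
- apply: (@le_lt_trans _ _ (del * (eps / 2))%:E); last first.
    rewrite lte_fin (@le_lt_trans _ _ (eta / eps * (eps / 2)))//.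
      by rewrite ler_pM2r// ge_min lexx orbT.
    by rewrite mulrA divfK ?gt_eqF// gtr_pMr// invf_lt1// ltr1n.
  rewrite EFinM; apply: (@le_trans _ _ (del%:E * \int[mu]_(x in D) (g x)%:E)%E).
    rewrite -ge0_integralZl//; last by rewrite lee_fin ltW.
    apply: ge0_le_integral => //.
    + apply/measurable_EFinP; apply: measurable_fun_powR_exponent => //.
      by apply: measurableT_comp => //; exact: measurable_funM.
    + by apply: measurable_funeM; exact/measurable_EFinP.
    + move=> x Dx; rewrite -EFinM lee_fin normrM (gtr0_norm del0).
      rewrite scaleuE ?(ltW del0)// ler_wpM2r//.
      by rewrite ge1r_powR ?del0// p1.
  by apply: lee_wpmul2l gD; rewrite lee_fin ltW.
(* A single k already beats e, so it suffices to integrate over B k. There |w + (1 + del) u| >= (1 +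
   del) |u| and p >= k^2, so the integrand is at least (1 + del)^(k^2) g. *)
have [k ek] := exp_square_dominates e del0 eps20.
apply: (@le_trans _ _
    (((1 + del) ^+ (k * k))%:E * (eps / 2 / (2 ^ k.+1)%:R)%:E)%E).
  by rewrite -EFinM lee_fin.
apply: (@le_trans _ _
    (((1 + del) ^+ (k * k))%:E * \int[mu]_(x in B k) (g x)%:E)%E).
  by apply: lee_wpmul2l (gB k); rewrite lee_fin exprn_ge0// addr_ge0// ltW.
have mgB : measurable_fun (B k) (EFin \o g).
  by apply/measurable_EFinP; exact: measurable_funS mg.
have mF : measurable_fun D (fun x => (`|(w + u + (fun x => del * u x)) x| `^ p x)%:E).
  apply/measurable_EFinP; apply: measurable_fun_powR_exponent => //.
  apply: measurableT_comp => //; do 2?apply: measurable_funD => //.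
  exact: measurable_funM.
rewrite -ge0_integralZl//; last first.
  by rewrite lee_fin exprn_ge0// addr_ge0// ltW.
apply: (@le_trans _ _ (\int[mu]_(x in B k)
    (`|(w + u + (fun x => del * u x)) x| `^ p x)%:E)%E); last first.
  by apply: ge0_subset_integral => // x _; rewrite lee_fin powR_ge0.
apply: ge0_le_integral => //.
- by move=> x _; rewrite mule_ge0// ?lee_fin// exprn_ge0// addr_ge0// ltW.
- exact: measurable_funeM.
- exact: measurable_funS mF.
move=> x Bx; have Dx := BD _ _ Bx; rewrite -EFinM lee_fin.
have -> : `|(w + u + (fun x => del * u x)) x| = `|w x| + (1 + del) * `|u x|.
  have -> : (w + u + (fun x => del * u x)) x = w x + (1 + del) * u x.
    by rewrite !fctE; ring.
  rewrite normu /u; have := powR_ge0 (g x) (p x)^-1.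
  move: (_ `^ _) => r r0; rewrite /s; case: ltP => [w0|w0].
    have dr0 : 0 <= (1 + del) * r by rewrite mulr_ge0// addr_ge0// ltW.
    by rewrite (ltr0_norm w0) ltr0_norm; [ring|lra].
  by rewrite mul1r !ger0_norm// addr_ge0// mulr_ge0// addr_ge0// ltW.
have del10 : 0 <= 1 + del by rewrite addr_ge0// ltW.
apply: (@le_trans _ _ (((1 + del) * `|u x|) `^ p x)); last first.
  apply: ge0_ler_powR; rewrite ?nnegrE ?lerDr ?addr_ge0 ?mulr_ge0//.
  by rewrite (le_trans ler01)// p1.
rewrite scaleuE// ler_wpM2r// -powR_mulrn//.
by rewrite ler_powR ?lerDl ?(ltW del0)//; case: (PB k) => _ _ _; exact.
Qed.

(** * Lebesgue outer measure of a box *)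

(* The weights C and c absorb the indicators of the coordinates already fixed,
   which makes the induction on n go through. *)
Lemma prod_measure_le_cover d (T : measurableType d) (R : realType)
    (mu : {measure set T -> \bar R}) (n : nat) (C : \bar R) (c : nat -> \bar R)
    (A : 'I_n -> set T) (B : nat -> 'I_n -> set T) :
  (0 <= C)%E -> (forall k, 0 <= c k)%E ->
  (forall i, measurable (A i)) -> (forall k i, measurable (B k i)) ->
  (forall x : 'I_n -> T, C * \prod_i (\1_(A i) (x i))%:E <=
     \sum_(0 <= k <oo) c k * \prod_i (\1_(B k i) (x i))%:E)%E ->
  (C * \prod_i mu (A i) <= \sum_(0 <= k <oo) c k * \prod_i mu (B k i))%E.
Proof.
elim: n => [|n IHn] in C c A B *; move=> C0 c0 mA mB CAcB.
  have x : 'I_0 -> T by case.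
  have := CAcB x; rewrite !big_ord0.
  by under eq_eseriesr do rewrite big_ord0;
     under [in X in _ -> X]eq_eseriesr do rewrite big_ord0.
have prod_mu0 (F : 'I_n -> set T) : (0 <= \prod_i mu (F i))%E.
  by apply: prode_ge0 => i _; exact: measure_ge0.
have ind0 (F : set T) (t : T) : (0 <= (\1_F t)%:E :> \bar R)%E by [].
pose A' i := A (lift ord0 i); pose B' k i := B k (lift ord0 i).
(* Freeze the first coordinate at t: its indicators become part of the weights. Integrating the
   resulting inequality over t then restores the factors mu (A ord0) and mu (B k ord0). *)
have slice t : (C * (\1_(A ord0) t)%:E * \prod_i mu (A' i) <=
    \sum_(0 <= k <oo) c k * (\1_(B k ord0) t)%:E * \prod_i mu (B' k i))%E.
  apply: IHn => [|k|i|k i|]; [exact: mule_ge0|exact: mule_ge0|exact: mA|exact: mB|].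
  move=> y; pose x i := oapp y t (unlift ord0 i).
  have := CAcB x; rewrite big_ord_recl muleA /x unlift_none /=.
  under eq_bigr do rewrite liftK /=.
  move=> /le_trans; apply; apply: lee_nneseries => [k _ _|k _].
    by rewrite mule_ge0// prode_ge0.
  rewrite big_ord_recl muleA unlift_none /=.
  by under eq_bigr do rewrite liftK /=.
rewrite big_ord_recl.
under eq_eseriesr do rewrite big_ord_recl.
have intE (b : \bar R) (F : set T) (G : 'I_n -> set T) : (0 <= b)%E ->
    measurable F -> (\int[mu]_t (b * (\1_F t)%:E * \prod_i mu (G i)) =
    b * (mu F * \prod_i mu (G i)))%E.
  move=> b0 mF; rewrite ge0_integralZr//; last 2 first.
  - by apply: measurable_funeM; exact/measurable_EFinP/measurable_indic.
  - by move=> t _; exact: mule_ge0.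
  rewrite ge0_integralZl//; last exact/measurable_EFinP/measurable_indic.
  by rewrite integral_indic// setIT muleA.
rewrite -intE//; under [leRHS]eq_eseriesr do rewrite -intE//.
have mI (b : \bar R) (F : set T) (G : 'I_n -> set T) : measurable F ->
    measurable_fun setT (fun t => b * (\1_F t)%:E * \prod_i mu (G i))%E.
  move=> mF; apply: emeasurable_funM => //; apply: measurable_funeM.
  exact/measurable_EFinP/measurable_indic.
rewrite -integral_nneseries//; last 2 first.
- by move=> k; exact: mI.
- by move=> k t _; do 2?apply: mule_ge0.
apply: ge0_le_integral => //.
- by move=> t _; do 2?apply: mule_ge0.
- exact: mI.
- apply: ge0_emeasurable_sum => [k t _ _|k _]; last exact: mI.
  by do 2?apply: mule_ge0.
Qed.
(** This is additivity of length when ]a, b] is cut at t; the truncations at 0 cover empty intervals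
    and cuts outside the interval. *)
Lemma max_sub_split (R : realDomainType) (a b t : R) :
  Num.max 0 (b - a) =
  Num.max 0 (Num.min b t - a) + Num.max 0 (b - Num.max a t).
Proof.
have max0 x : x <= 0 -> Num.max 0 x = 0 :> R by move=> ?; rewrite max_l.
have [ba|/ltW ab] := leP b a.
  by rewrite !max0 ?addr0// subr_le0 ?ge_min ?le_max ba.
have [bt|/ltW tb] := leP b t.
  by rewrite [X in _ = _ + X]max0 ?addr0// subr_le0 le_max bt orbT.
have [at_|/ltW ta] := leP a t; last by rewrite [X in _ = X + _]max0 ?add0r// subr_le0.
by rewrite !max_r ?subr_ge0//; ring.
Qed.

Lemma lebesgue_measure_itv_oc (R : realType) (a b : R) :
  lebesgue_measure (`]a, b]%classic : set R) = (Num.max 0 (b - a))%:E.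
Proof.
rewrite lebesgue_measure_itv/= lte_fin; case: ltP => [ab|ba].
  by rewrite -EFinB max_r// subr_ge0 ltW.
by rewrite max_l// subr_le0.
Qed.

Lemma box_volume_prod (R : realType) n (c : 'rV[R]_n.+1 * 'rV[R]_n.+1) :
  box_volume c =
  (\prod_i lebesgue_measure (`](c.1 ord0 i), (c.2 ord0 i)]%classic : set R))%E.
Proof.
by rewrite /box_volume -prodEFin; apply: eq_bigr => i _; rewrite lebesgue_measure_itv_oc.
Qed.

Lemma box_indic (R : realType) n (c : 'rV[R]_n.+1 * 'rV[R]_n.+1) (x : 'rV[R]_n.+1) :
  (\prod_i (\1_(`](c.1 ord0 i), (c.2 ord0 i)]%classic) (x ord0 i))%:E =
   (\1_(box c) x)%:E :> \bar R)%E.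
Proof.
rewrite prodEFin; congr EFin; have [cx|ncx] := pselect (box c x).
  rewrite indicE mem_set// big1// => i _; rewrite indicE mem_set//=.
  by rewrite in_itv/=; exact: cx.
rewrite [RHS]indicE memNset//.
have /existsNP[i nci] := ncx.
by rewrite (bigD1 i)//= indicE memNset ?mul0r//= in_itv.
Qed.

(** The substance is the lower bound: a covering is a pointwise inequality between indicators of
    boxes, and these are products over the coordinates, so [prod_measure_le_cover] applies with all
    weights equal to 1. *)
Lemma lebesgue_outer_box (R : realType) n (c : 'rV[R]_n.+1 * 'rV[R]_n.+1) :
  lebesgue_outer (box c) = box_volume c.
Proof.
apply/eqP; rewrite eq_le; apply/andP; split.
  (* The box covers itself; the sequence is filled up with degenerate boxes of volume 0. *)
  pose c' (k : nat) : 'rV[R]_n.+1 * 'rV[R]_n.+1 := if k is 0%N then c else (0, 0).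
  apply: ereal_inf_lbound; exists c'; first by move=> x cx; exists 0%N.
  rewrite nneseries_recl//; last by move=> k _; exact: box_volume_ge0.
  rewrite eseries_cond/= eseries0 ?adde0// => -[|k] _ _ //=.
  by rewrite /box_volume/= big_ord_recl mxE subrr maxxx mul0r.
apply: le_ereal_inf_tmp => _ [c' cc' <-].
have := @prod_measure_le_cover _ _ R lebesgue_measure n.+1 1 (fun=> 1%E)
  (fun i => `](c.1 ord0 i), (c.2 ord0 i)]%classic)
  (fun k i => `]((c' k).1 ord0 i), ((c' k).2 ord0 i)]%classic).
rewrite mul1e -box_volume_prod.
under eq_eseriesr do rewrite mul1e -box_volume_prod.
apply => // y; pose x : 'rV[R]_n.+1 := \row_i y i.
have yE i : y i = x ord0 i by rewrite mxE.
rewrite mul1e; under eq_bigr do rewrite yE; rewrite box_indic.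
under eq_eseriesr do (rewrite mul1e; under eq_bigr do rewrite yE; rewrite box_indic).
have [cx|ncx] := pselect (box c x); last first.
  by rewrite indicE memNset//; exact: nneseries_ge0.
have [k _ ckx] := cc' _ cx.
rewrite indicE mem_set// (@nneseriesD1 _ _ k)// [X in (X%:E + _)%E]indicE mem_set//.
by rewrite leeDl// nneseries_ge0.
Qed.

(** * Measurability of boxes and open sets *)

(** Cutting every box of a cover of X at height t in direction i yields covers of the two parts of
    X. By [max_sub_split] in coordinate i, the other factors being unchanged, the total volume is
    preserved. *)
Lemma halfspace_caratheodory (R : realType) n (i : 'I_n.+1) (t : R) :
  (@lebesgue_outer R n).-caratheodory [set x | x ord0 i <= t].
Proof.
apply: le_caratheodory_measurable => X; set H := [set x | _].
apply: le_ereal_inf_tmp => _ [c Xc <-].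
pose lo k : 'rV[R]_n.+1 * 'rV[R]_n.+1 :=
  ((c k).1, \row_j if j == i then Num.min ((c k).2 ord0 i) t else (c k).2 ord0 j).
pose hi k : 'rV[R]_n.+1 * 'rV[R]_n.+1 :=
  (\row_j if j == i then Num.max ((c k).1 ord0 i) t else (c k).1 ord0 j, (c k).2).
have -> : (\sum_(0 <= k <oo) box_volume (c k) =
    \sum_(0 <= k <oo) (box_volume (lo k) + box_volume (hi k)))%E.
  apply: eq_eseriesr => k _.
  have volE c' : box_volume c' = (Num.max 0 (c'.2 ord0 i - c'.1 ord0 i) *
      \prod_(j | j != i) Num.max 0 (c'.2 ord0 j - c'.1 ord0 j))%:E.
    by move=> *; rewrite /box_volume (bigD1 i).
  rewrite !volE -EFinD /= !mxE eqxx.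
  under [in X in _ = (X + _)%:E]eq_bigr => j /negPf ji do rewrite mxE ji.
  under [in X in _ = (_ + X)%:E]eq_bigr => j /negPf ji do rewrite mxE ji.
  rewrite -mulrDl; congr (_ * _)%:E.
  exact: max_sub_split.
rewrite nneseriesD; [|by move=> k _ _; exact: box_volume_ge0..].
apply: leeD; apply: ereal_inf_lbound.
- exists lo => // x [/Xc[k _ ckx] Hx]; exists k => // j /=; rewrite mxE.
  have /andP[-> xj] := ckx j; case: eqVneq => [ji|//] /=.
  by rewrite le_min -ji xj [j]ji Hx.
- exists hi => // x [/Xc[k _ ckx] /negP Hx]; exists k => // j /=; rewrite mxE.
  have /andP[xj ->] := ckx j; rewrite andbT; case: eqVneq => [ji|//] /=.
  by rewrite gt_max -ji xj [j]ji ltNge Hx.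
Qed.

Lemma measurable_box (R : realType) n (c : 'rV[R]_n.+1 * 'rV[R]_n.+1) :
  (@lebesgue_outer R n).-cara.-measurable (box c).
Proof.
have -> : box c = \bigcap_(i in [set: 'I_n.+1])
    ([set x | x ord0 i <= c.2 ord0 i] `\` [set x | x ord0 i <= c.1 ord0 i]).
  apply/seteqP; split => [x cx i _|x cx i].
    by have /andP[ci ic] := cx i; split => //=; apply/negP; rewrite -ltNge.
  by have [/= -> /negP] := cx i I; rewrite -ltNge andbT.
apply: fin_bigcap_measurable => // i _.
by apply: measurableD; exact: halfspace_caratheodory.
Qed.

(** Rational corners leave only countably many boxes, as [open_caratheodory] requires. Since x lies
    strictly between the corners, the box has positive volume, as [open_subset_box] requires. *)
Lemma open_rat_box (R : realType) n (U : set 'rV[R]_n.+1) x : open U -> U x ->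
  exists q : 'rV[rat]_n.+1 * 'rV[rat]_n.+1,
    let c := (map_mx ratr q.1, map_mx ratr q.2) in
    [/\ forall i, c.1 ord0 i < x ord0 i < c.2 ord0 i & box c `<=` U].
Proof.
move=> oU Ux; have /nbhs_ballP[e /= e0 xeU] : nbhs x U by exact: open_nbhs_nbhs.
have /choice[q1 q1P] : forall i, exists q : rat,
    x ord0 i - e < ratr q < x ord0 i.
  move=> i; have : x ord0 i - e < x ord0 i by rewrite ltrBlDr ltrDl.
  by move=> /rat_in_itvoo[q]; rewrite in_itv/= => xq; exists q.
have /choice[q2 q2P] : forall i, exists q : rat,
    x ord0 i < ratr q < x ord0 i + e.
  move=> i; have : x ord0 i < x ord0 i + e by rewrite ltrDl.
  by move=> /rat_in_itvoo[q]; rewrite in_itv/= => xq; exists q.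
exists (\row_i q1 i, \row_i q2 i); split => [i|y cy] /=.
  by rewrite !mxE; have /andP[_ ->] := q1P i; have /andP[-> _] := q2P i.
apply: xeU; split => // i j; rewrite ord1 /ball/= ltr_distl.
have := cy j; rewrite /= !mxE => /andP[y1 y2].
have /andP[x1 _] := q1P j; have /andP[_ x2] := q2P j.
by apply/andP; split; lra.
Qed.

Lemma open_caratheodory (R : realType) n (U : set 'rV[R]_n.+1) : open U ->
  (@lebesgue_outer R n).-cara.-measurable U.
Proof.
move=> oU; pose c (q : 'rV[rat]_n.+1 * 'rV[rat]_n.+1) : 'rV[R]_n.+1 * 'rV[R]_n.+1 :=
  (map_mx ratr q.1, map_mx ratr q.2).
(* Indexing by all pairs of rational corners, with the empty set for boxes not inside U, keeps the
   index type countable. *)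
have -> : U = \bigcup_q (if `[< box (c q) `<=` U >] then box (c q) else set0).
  apply/seteqP; split => [x Ux|x [q _]]; last by case: asboolP => // cU /cU.
  have [q [xq qU]] := open_rat_box oU Ux.
  exists q => //; rewrite asboolT// => i.
  by have /andP[-> /ltW] := xq i.
apply: (@countable_bigcupT_measurable _ (caratheodory_type lebesgue_outer)) => [|q].
  exact: countableP.
by case: ifP => _; [exact: measurable_box|exact: measurable0].
Qed.

Lemma open_subset_box (R : realType) n (U : set 'rV[R]_n.+1) :
  open U -> U !=set0 -> exists c, box c `<=` U /\ (0 < lebesgue_outer (box c) < +oo)%E.
Proof.
move=> oU [x Ux]; have [q [xq qU]] := open_rat_box oU Ux.
exists (map_mx ratr q.1, map_mx ratr q.2); split => //.
rewrite lebesgue_outer_box ltry andbT lte_fin; apply: prodr_gt0 => i _.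
have /andP[q1 q2] := xq i.
by rewrite lt_max subr_gt0 (lt_trans q1 q2) orbT.
Qed.

(** * Stability of the modular spaces under subtraction *)

(** With l half the smaller scale, |l (a - b)| is at most the larger of |l1 a| and |l2 b|, whose
    p-th power is at most the sum of the two powers. This avoids a constant such as 2^p, which need
    not be bounded. *)
Lemma fun_modular_subspace d (T : measurableType d) (R : realType)
    (mu : {measure set T -> \bar R}) (D : set T) (p a b : T -> R) :
  measurable D -> measurable_fun D p -> (forall x, D x -> 1 <= p x) ->
  measurable_fun D a -> measurable_fun D b ->
  (exists2 l : R, 0 < l & (fun_modular mu D p (fun x => l * a x)%R < +oo)%E) ->
  (exists2 l : R, 0 < l & (fun_modular mu D p (fun x => l * b x)%R < +oo)%E) ->
  exists2 l : R, 0 < l &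
    (fun_modular mu D p (fun x => l * (a - b) x)%R < +oo)%E.
Proof.
move=> mD mp p1 ma mb [l1 l10 al1] [l2 l20 bl2].
pose l := Num.min l1 l2 / 2; have l0 : 0 < l by rewrite divr_gt0// lt_min l10.
have mpow (c : R) (f : T -> R) : measurable_fun D f ->
    measurable_fun D (fun x => (`|c * f x| `^ p x)%:E).
  move=> mf; apply/measurable_EFinP; apply: measurable_fun_powR_exponent => //.
  by apply: measurableT_comp => //; exact: measurable_funM.
exists l => //; apply: le_lt_trans (lte_add_pinfty al1 bl2).
have mpa := mpow l1 a ma; have mpb := mpow l2 b mb.
rewrite /fun_modular -ge0_integralD//.
apply: ge0_le_integral => //.
- by apply: mpow; exact: measurable_funB.
- exact: emeasurable_funD.
move=> x Dx; rewrite -EFinD lee_fin.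
have px0 : 0 <= p x by rewrite (le_trans ler01)// p1.
have lab : `|l * (a - b) x| <= Num.max `|l1 * a x| `|l2 * b x|.
  rewrite normrM (gtr0_norm l0) (_ : (a - b) x = a x - b x)//.
  apply: (@le_trans _ _ (l * (`|a x| + `|b x|))).
    by rewrite ler_pM2l// ler_normB.
  rewrite !normrM (gtr0_norm l10) (gtr0_norm l20).
  have m1 : Num.min l1 l2 <= l1 by rewrite ge_min lexx.
  have m2 : Num.min l1 l2 <= l2 by rewrite ge_min lexx orbT.
  have /(ler_wpM2r (normr_ge0 (a x))) a1 := m1.
  have /(ler_wpM2r (normr_ge0 (b x))) b1 := m2.
  rewrite /l le_max; have [ab|/ltW ba] := leP (l1 * `|a x|) (l2 * `|b x|).
    by apply/orP; right; lra.
  by apply/orP; left; lra.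
apply: (le_trans (ge0_ler_powR px0 _ _ lab)); rewrite ?nnegrE ?le_max ?normr_ge0//.
by case: (leP `|l1 * a x| `|l2 * b x|) => _; rewrite ?lerDl ?lerDr powR_ge0.
Qed.

Lemma fun_modular_lty_space d (T : measurableType d) (R : realType)
    (mu : {measure set T -> \bar R}) (D : set T) (p u : T -> R) (e : R) :
  (fun_modular mu D p u < e%:E)%E ->
  exists2 l : R, 0 < l & (fun_modular mu D p (fun x => l * u x)%R < +oo)%E.
Proof.
move=> ue; exists 1 => //; under eq_fun do rewrite mul1r.
exact: lt_trans ue (ltry _).
Qed.

(** * Sequence spaces via the counting measure *)

Lemma seq_modular_counting (R : realType) (p a : nat -> R) :
  seq_modular p a = fun_modular counting setT p a.
Proof.
by rewrite /fun_modular ge0_integral_count// => k; rewrite lee_fin powR_ge0.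
Qed.

Lemma seq_modular_ball_interior0 (R : realType) (p : nat -> R) :
  (forall k, 1 <= p k) -> ~ bounded_fun p ->
  forall (x : var_lseq p) (e : R), (modular_ball x e)° = set0.
Proof.
move=> p1 pnb x e.
have mfun (f : nat -> R) : measurable_fun setT f by [].
have unb (m : nat) : exists k, m%:R <= p k.
  apply: contrapT => /forallNP pm; apply: pnb; exists m%:R; split => // M mM k _ /=.
  rewrite ger0_norm ?(le_trans ler01)//; apply: le_trans (ltW mM).
  by have /negP := pm k; rewrite -ltNge => /ltW.
have spaceE u : seq_space p u <-> exists2 l : R, 0 < l &
    (fun_modular counting setT p (fun k => l * u k)%R < +oo)%E.
  by split=> -[l l0 lu]; exists l => //; rewrite ?seq_modular_counting// in lu *.
apply: modular_ball_interior0 => [u v /spaceE lu /spaceE lv|w _ eps eps0].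
  by apply/spaceE; apply: fun_modular_subspace.
have [|u [_ ueps uP]] := @exists_perturbation _ _ R counting setT p w eps e
  measurableT (mfun p) (fun k _ => p1 k) _ (mfun w) eps0.
  (* For the counting measure the sets of large exponent can be singletons, of measure 1. *)
  move=> m; have [k mk] := unb m; exists [set k]; split => //.
    have ck : counting [set k] = 1%:E :> \bar R.
      by rewrite /counting asboolT// fset_set1 finmap.cardfs1.
    by rewrite [X in (_ < X < _)%E]ck lte_fin ltr01 ltry.
  by move=> _ ->.
exists u; split.
- by apply/spaceE; exact: fun_modular_lty_space ueps.
- by rewrite seq_modular_counting.
move=> eta /uP[v [_ veta ev]]; exists v; split.
- by apply/spaceE; exact: fun_modular_lty_space veta.
- by rewrite seq_modular_counting.
- by rewrite seq_modular_counting.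
Qed.

(** * Lebesgue spaces of classes of functions *)

(** The representative picked by [repr] agrees with u only almost everywhere on D. Completeness of
    mu makes it measurable there, after which the two integrals coincide. *)
Lemma class_modular_pi d (T : measurableType d) (R : realType)
    (mu : {measure set T -> \bar R}) (D : set T) (p u : T -> R) :
  measure_is_complete mu -> measurable D -> measurable_fun D p ->
  measurable_fun D u ->
  class_modular mu D p (\pi_(ae_class mu D)%qT u) = fun_modular mu D p u.
Proof.
move=> cmu mD mp mfu; rewrite /class_modular; set v := repr _.
have uv : u = v %[ae mu in D].
  have : v = u %[mod ae_class mu D]%qT by rewrite reprK.
  move/eqP; rewrite -Quotient.idealrBE => /asboolP.
  apply: filterS => x vu Dx; have := vu Dx.
  by rewrite (_ : (v - u) x = v x - u x)//= => /subr0_eq.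
have mv : measurable_fun D v.
  apply/measurable_EFinP; apply: (ae_measurable_fun cmu) => /=; last first.
    exact/measurable_EFinP/mfu.
  by apply: filterS uv => x uv Dx /=; rewrite uv.
apply: ge0_ae_eq_integral => //.
- apply/measurable_EFinP; apply: measurable_fun_powR_exponent => //.
  exact: measurableT_comp.
- apply/measurable_EFinP; apply: measurable_fun_powR_exponent => //.
  exact: measurableT_comp.
- by move: uv; apply: filterS => x uvx Dx; rewrite uvx.
Qed.

Lemma class_modular_ball_interior0 d (T : measurableType d) (R : realType)
    (mu : {measure set T -> \bar R}) (D : set T) (p : T -> R) :
  measure_is_complete mu -> measurable D -> measurable_fun D p ->
  (forall x, D x -> 1 <= p x) ->
  (forall m : nat, exists B, [/\ measurable B, B `<=` D,
     (0 < mu B < +oo)%E & forall x, B x -> m%:R <= p x]) ->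
  forall (f : var_Lspace mu D p) (e : R), (modular_ball f e)° = set0.
Proof.
move=> cmu mD mp p1 pB f e.
apply: modular_ball_interior0 => [_ _ [a [ma la] <-] [b [mb lb] <-]|].
  exists (a - b); last exact: raddfB.
  by split; [exact: measurable_funB|exact: fun_modular_subspace].
move=> _ [w [mw _] <-] eps eps0.
have [u [mfu ueps uP]] := exists_perturbation e mD mp p1 pB mw eps0.
exists (\pi_(ae_class mu D)%qT u); split.
- by exists u => //; split => //; exact: fun_modular_lty_space ueps.
- by rewrite class_modular_pi.
move=> eta /uP[v [mv veta ev]]; exists (\pi_(ae_class mu D)%qT v); split.
- by exists v => //; split => //; exact: fun_modular_lty_space veta.
- by rewrite class_modular_pi.
- rewrite -!raddfD class_modular_pi//.
  by do 2?apply: measurable_funD.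
Qed.

(** Open rays generate the Borel sets, and their preimages within the open set Omega are open, hence
    Caratheodory measurable. *)
Lemma measurable_fun_open_continuous (R : realType) n (Omega : set 'rV[R]_n.+1)
    (p : 'rV[R]_n.+1 -> R) : open Omega -> {within Omega, continuous p} ->
  measurable_fun (Omega : set (caratheodory_type lebesgue_outer)) p.
Proof.
move=> oO; rewrite continuous_open_subspace// => /(continuous_inP p oO) cp mO.
apply: (measurability _ (RGenOInfty.measurableE R)) => // _ [_ [x ->] <-].
apply: open_caratheodory; apply: cp.
exact: interval_open.
Qed.

Theorem corollary6p4 (R : realType) :
  (forall p : nat -> R,
     (forall k, 1 <= p k) -> ~ bounded_fun p ->
     forall (x : var_lseq p) (e : R), 0 < e ->
       (modular_ball x e)° = set0)
  /\
  (forall (n : nat) (Omega : set 'rV[R]_n.+1) (p : 'rV[R]_n.+1 -> R),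
     Omega !=set0 -> open Omega -> connected Omega -> bounded_set Omega ->
     {within Omega, continuous p} ->
     (forall x, Omega x -> 1 <= p x) ->
     ereal_sup [set (p x)%:E | x in Omega] = +oo%E ->
     forall (f : var_Lspace lebesgue_rV Omega p) (e : R), 0 < e ->
       (modular_ball f e)° = set0).
Proof.
split=> [p p1 pnb x e _|n Omega p _ oO _ _ cp p1 psup f e _].
  exact: seq_modular_ball_interior0.
have cpO := cp; rewrite continuous_open_subspace// in cpO.
apply: class_modular_ball_interior0 => //.
- exact: measure_is_complete_caratheodory.
- exact: open_caratheodory.
- exact: measurable_fun_open_continuous.
move=> m; pose U := Omega `&` p @^-1` `]m%:R, +oo[.
have oU : open U by apply: (continuous_inP p oO).1 => //; exact: interval_open.
(* If U were empty, m would bound p on Omega, contradicting the infinite supremum. *)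
have U0 : U !=set0.
  apply: contrapT => /forallNP U0; suff : (+oo <= m%:R%:E :> \bar R)%E by [].
  rewrite -psup; apply: ge_ereal_sup => _ [x Ox <-]; rewrite lee_fin leNgt.
  by apply/negP => mx; apply: (U0 x); split => //=; rewrite in_itv/= mx.
have [c [cU c0]] := open_subset_box oU U0.
exists (box c); split => //.
- exact: measurable_box.
- by move=> x /cU[].
- by move=> x /cU[_ /=]; rewrite in_itv/= andbT => /ltW.
Qed.
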